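(* Consider the Probabilistic Serial mechanism with $n$ agents and $m$ items, where $n \ge m$. Let $i$ be any agent whose true preferences are a strict linear order $\succ_i$ over the $m$ items together with cardinal utilities $a_{ij} \in [0,1]$ compatible with $\succ_i$ (i.e. $a_{ij} > a_{ij'}$ whenever $j \succ_i j'$). Fix arbitrary reported strict linear orders $\succ_{-i}$ of all other agents. Then for every strict linear order $\succ'_i$ over the items, $$u_i(\succ'_i, \succ_{-i}) \le \tfrac{3}{2}\, u_i(\succ_i, \succ_{-i}).$$ Equivalently, the incentive ratio of the Probabilistic Serial mechanism is at most $\tfrac{3}{2}$ when $n \ge m$.
   Context: There are $n$ agents and $m$ divisible items, each of unit supply. Each agent reports a strict linear order over all $m$ items. The Probabilistic Serial mechanism runs the simultaneous eating algorithm: starting at time $0$, every agent consumes, at rate $1$ (one unit of item per unit of time), its most preferred item (according to its report) among the items with positive remaining supply; whenever an item is exhausted, each agent consuming it moves on to its most preferred item still having positive remaining supply; this continues until all items are exhausted. Let $x_{ij}$ be the total amount of item $j$ consumed by agent $i$. The (expected) utility of agent $i$ with cardinal utilities $a_{ij}$ is $u_i = \sum_j a_{ij} x_{ij}$; $u_i(\succ'_i,\succ_{-i})$ denotes this utility (computed with agent $i$'s true $a_{ij}$) when agent $i$ reports $\succ'_i$ and the others report $\succ_{-i}$. The incentive ratio of agent $i$ is $\max_{\succ_{-i}} \max_{\succ'_i} u_i(\succ'_i,\succ_{-i})/u_i(\succ_i,\succ_{-i})$, and the incentive ratio of the mechanism is the maximum over agents. *)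

(* Defs.v *)
From HB Require Import structures.
From mathcomp Require Import all_boot all_order all_algebra all_fingroup.
Set Implicit Arguments.
Unset Strict Implicit.
Unset Printing Implicit Defensive.
Import Order.TTheory GRing.Theory Num.Theory.
Local Open Scope ring_scope.

Section PS.
Variables (R : realFieldType) (n m : nat).

(* A strict linear order over the items 'I_m is encoded as a ranking
   permutation r : {perm 'I_m}: r j is the rank of item j (0 = best),
   so j is preferred to j' iff r j < r j'.  A profile gives one ranking
   per agent 'I_n. *)
Definition profile := 'I_n -> {perm 'I_m}.

Definition eats (P : profile) (s : 'I_m -> R) (k : 'I_n) (j : 'I_m) : bool :=
  (0 < s j) && [forall j' : 'I_m, (0 < s j') ==> (P k j <= P k j')%N].

Definition eaters (P : profile) (s : 'I_m -> R) (j : 'I_m) : nat :=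
  #|[set k | eats P s k j]|.

(* length of the current phase: time until the first item currently being
   eaten is exhausted, i.e. min over eaten items of s_j / c_j.
   (Supplies always lie in [0,1] and c_j >= 1, so 1 is a neutral upper
   bound for this minimum.) *)
Definition phase_len (P : profile) (s : 'I_m -> R) : R :=
  \big[Order.min/1]_(j | (0 < eaters P s j)%N) (s j / (eaters P s j)%:R).

Definition ps_step (P : profile)
    (st : ('I_m -> R) * ('I_n -> 'I_m -> R)) :
    ('I_m -> R) * ('I_n -> 'I_m -> R) :=
  let s := st.1 in let x := st.2 in
  let d := phase_len P s in
  (fun j => s j - (eaters P s j)%:R * d,
   fun k j => x k j + (if eats P s k j then d else 0)).

(* Each phase exhausts at least one item, so m phases suffice to exhaust
   all items; later phases (if any) would be no-ops.
   PS P k j = x_{kj}, the amount of item j consumed by agent k. *)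
Definition PS (P : profile) : 'I_n -> 'I_m -> R :=
  (iter m (ps_step P) (fun _ => 1, fun _ _ => 0)).2.

Definition utility (a : 'I_m -> R) (P : profile) (k : 'I_n) : R :=
  \sum_(j : 'I_m) a j * PS P k j.

Definition deviate (P : profile) (k : 'I_n) (p' : {perm 'I_m}) : profile :=
  fun k' => if k' == k then p' else P k'.

End PS.

(* Main.v *)
(* Everything is read off the exhaustion times [t j]: an agent eats [j] from the
   time its better items are all exhausted until [t j].

   By Abel summation it is enough to compare what agent [i] eats of its [r] best
   items [S].  Truthfully this is the time [T] at which [S] is exhausted.  Let
   [t'] be the exhaustion times after the manipulation and [D] the items with
   [t j <= T] and [t j < t' j].  By time [T] every other agent has eaten at least
   as much of [D] as it did under the truthful report, so at most
   [T - (what i has eaten of D)] is left of [D].  If [T < 1], it follows that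
   after [T] agent [i] never eats an item of [S] alone: nobody else would have
   touched that item before [T], and too much of it would be left.  Hence [i]
   gets at most half of the leftover of [S] after [T], and in total at most
   [T + T / 2].  If [T >= 1], the hypothesis [m <= n] bounds the total
   consumption of [i] by [1 <= T]. *)
Require Import Defs.
From HB Require Import structures.
From mathcomp Require Import all_boot all_order all_algebra all_fingroup.
From mathcomp Require Import lra.
Import Order.TTheory GRing.Theory Num.Theory.
Local Open Scope ring_scope.

Set Implicit Arguments.
Unset Strict Implicit.
Unset Printing Implicit Defensive.

(** The successor step names the item [j] of rank [r], by which a sum or maximum over the [r] best
    items grows. *)
Lemma rank_ind (m : nat) (p : {perm 'I_m}) (K : nat -> Prop) :
  K 0%N -> (forall j, K (p j) -> K (p j).+1) ->
  forall r, (r <= m)%N -> K r.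
Proof.
move=> K0 KS; elim=> // r IHr ltrm.
have -> : r = p (p^-1%g (Ordinal ltrm)) by rewrite permKV.
by apply: KS; rewrite permKV; apply: IHr; apply: ltnW.
Qed.

Ltac no_minmax x :=
  lazymatch x with
  | context [Order.max _ _] => fail
  | context [Order.min _ _] => fail
  | _ => idtac
  end.

Ltac minmax_lra :=
  repeat match goal with
  | |- context [Order.max ?x ?y] => no_minmax x; no_minmax y; case: (leP x y) => ?
  | |- context [Order.min ?x ?y] => no_minmax x; no_minmax y; case: (leP x y) => ?
  end; lra.

(** * Consumption as a function of exhaustion times *)

Section Ranking.
Variables (R : realFieldType) (m : nat).
Implicit Types (p : {perm 'I_m}) (t : 'I_m -> R).

(* [peak p t r] is the time at which the [r] best items for [p] are all
   exhausted, when [t j] is the exhaustion time of [j]; an agent with ranking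
   [p] starts eating [j] at time [peak p t (p j)], if at all. *)
Definition peak p t (r : nat) : R := \big[Order.max/0]_(j | (p j < r)%N) t j.

Definition share p t (j : 'I_m) : R := Num.max 0 (t j - peak p t (p j)).

Lemma rank_ltS p j l : (p l < (p j).+1)%N && (l != j) = (p l < p j)%N.
Proof.
rewrite ltnS [RHS]ltn_neqAle andbC; congr (~~ _ && _).
by rewrite -(inj_eq (@perm_inj _ p)).
Qed.

Lemma sum_rankS p (Q : pred 'I_m) (F : 'I_m -> R) j :
  \sum_(l | (p l < (p j).+1)%N && Q l) F l =
  (if Q j then F j else 0) + \sum_(l | (p l < p j)%N && Q l) F l.
Proof.
rewrite !big_mkcondr /= (bigD1 j) //=; congr (_ + _).
by apply: eq_bigl => l; rewrite rank_ltS.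
Qed.

Lemma peak0 p t : peak p t 0 = 0.
Proof. by rewrite /peak big_pred0. Qed.

Lemma peakS p t j : peak p t (p j).+1 = Num.max (t j) (peak p t (p j)).
Proof.
rewrite /peak (bigmaxD1 j) //; congr Num.max.
by apply: eq_bigl => l; rewrite rank_ltS.
Qed.

Lemma peak_ge0 p t r : 0 <= peak p t r.
Proof. exact: bigmax_ge_id. Qed.

Lemma peak_le p t r B :
  0 <= B -> (forall j, (p j < r)%N -> t j <= B) -> peak p t r <= B.
Proof. by move=> *; apply: bigmax_le. Qed.

Lemma le_peak p t r j : (p j < r)%N -> t j <= peak p t r.
Proof. by move=> lt_jr; apply: (le_bigmax_cond 0 (fun j => t j)). Qed.

Lemma share_ge0 p t j : 0 <= share p t j.
Proof. by rewrite le_max lexx. Qed.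

Lemma peak_share p t j : peak p t (p j).+1 = share p t j + peak p t (p j).
Proof. by rewrite peakS /share; minmax_lra. Qed.

Lemma sum_share p t r :
  (r <= m)%N -> \sum_(j | (p j < r)%N) share p t j = peak p t r.
Proof.
move: r; apply: (@rank_ind m p) => [|j IHj]; first by rewrite peak0 big_pred0.
have := @sum_rankS p predT (share p t) j.
under eq_bigl do rewrite andbT.
under [in RHS]eq_bigl do rewrite andbT.
by rewrite IHj peak_share => ->.
Qed.

Lemma sum_share_all p t : \sum_j share p t j = peak p t m.
Proof. by rewrite -sum_share //; apply: eq_bigl => j; rewrite ltn_ord. Qed.

(* Delaying the exhaustion of the items of [D] and hastening that of the others
   makes an agent consume more of [D]. *)
Lemma sum_share_le p t t' (D : pred 'I_m) :
  (forall j, D j -> t j <= t' j) -> (forall j, ~~ D j -> t' j <= t j) ->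
  \sum_(j | D j) share p t j <= \sum_(j | D j) share p t' j.
Proof.
move=> leD leND.
pose F s r := \sum_(j | (p j < r)%N && D j) share p s j.
(* The second inequality, that consumption outside [D] does not grow, makes the induction close. *)
suff /(_ m (leqnn m)) [] : forall r, (r <= m)%N ->
    F t r <= F t' r /\ peak p t' r - F t' r <= peak p t r - F t r.
  rewrite /F; under eq_bigl do rewrite ltn_ord.
  by under [X in _ <= X -> _]eq_bigl do rewrite ltn_ord.
apply: (@rank_ind m p) => [|j]; rewrite /F.
  by rewrite !peak0 !big_pred0 //.
rewrite !sum_rankS !peakS /share.
set f := \sum_(l | _) _; set f' := \sum_(l | _) _.
case: ifPn => [/leD|/leND] le_tt' [leF leE]; split;
  minmax_lra.
Qed.

Lemma peak_min p t T r : 0 <= T -> (r <= m)%N ->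
  peak p (fun j => Num.min (t j) T) r = Num.min (peak p t r) T.
Proof.
move=> T0; move: r; apply: (@rank_ind m p) => [|j IHj].
  by rewrite !peak0; minmax_lra.
by rewrite !peakS IHj; minmax_lra.
Qed.

(* The two summands are the consumptions before and after time [T]. *)
Lemma share_cut p t T j : 0 <= T ->
  share p t j = share p (fun j => Num.min (t j) T) j
              + Num.max 0 (t j - Num.max T (peak p t (p j))).
Proof.
move=> T0; rewrite /share peak_min //; last exact: ltnW.
minmax_lra.
Qed.

Lemma abel_sum_ge0 p (a y : 'I_m -> R) :
  (forall j, 0 <= a j) ->
  (forall j j', (p j < p j')%N -> a j' <= a j) ->
  (forall r, (r <= m)%N -> 0 <= \sum_(j | (p j < r)%N) y j) ->
  0 <= \sum_j a j * y j.
Proof.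
move=> a0 amono Y0.
(* The induction carries any lower bound [b] of the weights so far, so that the weight of the next
   item can serve as the bound for all better ones. *)
suff H : forall r, (r <= m)%N -> forall b, 0 <= b ->
    (forall j, (p j < r)%N -> b <= a j) ->
    b * (\sum_(j | (p j < r)%N && predT j) y j) <=
    \sum_(j | (p j < r)%N && predT j) a j * y j.
  have := H m (leqnn m) 0 (lexx 0) (fun j _ => a0 j); rewrite mul0r.
  by under eq_bigl do rewrite ltn_ord.
apply: (@rank_ind m p) => [b _ _|j IHj b b0 ba].
  by rewrite !big_pred0 ?mulr0.
have Yj : 0 <= \sum_(l | (p l < (p j).+1)%N && predT l) y l.
  by under eq_bigl do rewrite andbT; apply: Y0.
have /le_trans -> // := ler_wpM2r Yj (ba j (ltnSn _)).
by rewrite !sum_rankS /= mulrDr lerD2l IHj // => l /amono.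
Qed.

End Ranking.

(** * From the phases of the algorithm to exhaustion times *)

Section EatingTimes.
Variables (R : realFieldType) (n m : nat) (P : 'I_n -> {perm 'I_m}).
Implicit Types (s t : 'I_m -> R).

Lemma phase_len_ge0 s : (forall j, 0 <= s j) -> 0 <= phase_len P s.
Proof. by move=> s0; apply: le_bigmin => // j _; rewrite divr_ge0. Qed.

Lemma eatersM_phase_len s j :
  (forall j, 0 <= s j) -> (eaters P s j)%:R * phase_len P s <= s j.
Proof.
move=> s0; have [->|c0] := posnP (eaters P s j); first by rewrite mul0r.
rewrite mulrC -ler_pdivlMr ?ltr0n //.
exact: (bigmin_le_cond _ (fun j => s j / (eaters P s j)%:R)).
Qed.

Lemma exists_eats s (k : 'I_n) j : 0 < s j -> exists l, eats P s k l.
Proof.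
move=> sj; have [l sl minl] :=
  @arg_minnP _ j (fun l => 0 < s l) (fun l => P k l) sj; exists l.
by rewrite /eats sl; apply/forallP => l'; apply/implyP/minl.
Qed.

Lemma phase_exhausts s (k : 'I_n) j :
  (forall j, s j <= 1) -> 0 < s j ->
  exists2 l, 0 < s l & (eaters P s l)%:R * phase_len P s = s l.
Proof.
move=> s1 /(exists_eats k)[l0 el0].
have c0 : (0 < eaters P s l0)%N by apply/card_gt0P; exists k; rewrite inE.
pose F l := s l / (eaters P s l)%:R.
(* Supplies are at most 1 and eaters at least one, so no quotient exceeds the default [1] and the
   minimum is attained. *)
have [|l lP eF] := @eq_bigmin _ R _ 1 l0 (fun l => (0 < eaters P s l)%N) F c0.
  move=> l cl; rewrite ler_pdivrMr ?ltr0n // mul1r.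
  by rewrite (le_trans (s1 l)) // ler1n.
have cl : (0 < eaters P s l)%N := lP.
exists l; first by have /card_gt0P[k'] := cl; rewrite inE => /andP[].
by rewrite /phase_len eF mulrC divfK // pnatr_eq0 -lt0n.
Qed.

(* [t j] is the minimum of the current time [tau] and of the exhaustion time
   of [j]. *)
Definition eating_invariant (tau : R) t (st : ('I_m -> R) * ('I_n -> 'I_m -> R)) :=
  [/\ 0 <= tau, forall j, 0 <= st.1 j, forall j, t j <= tau,
      forall j, 0 < st.1 j -> t j = tau &
      (forall k j, st.2 k j = share (P k) t j) /\
      (forall j, st.1 j = 1 - \sum_k st.2 k j)].

(** If an item better than [j] has supply left, its time is the current one before and after the
    phase, so both shares of [j] are zero. Otherwise the starting time of [j] is fixed and only
    [t j] can move. *)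
Lemma share_step s t (tau d : R) k j :
  0 <= d -> 0 <= tau -> (forall j, t j <= tau) ->
  (forall j, 0 < s j -> t j = tau) ->
  share (P k) (fun j => if 0 < s j then t j + d else t j) j =
  share (P k) t j + (if eats P s k j then d else 0).
Proof.
move=> d0 tau0 t_le ttau; rewrite /share.
set t1 := fun j => _; rewrite -/(t1 j).
have le_tt1 l : t l <= t1 l by rewrite /t1; case: ifP; lra.
have M0 := peak_ge0 (P k) t (P k j).
have leM : peak (P k) t (P k j) <= tau by apply: peak_le.
have [/existsP[l /andP[ltlj sl]]|no] :=
    boolP [exists l, (P k l < P k j)%N && (0 < s l)].
  have -> : eats P s k j = false.
    apply/negP => /andP[_ /forallP/(_ l)].
    by rewrite sl /= leqNgt ltlj.
  have Ml : tau <= peak (P k) t (P k j) by rewrite -(ttau l sl); exact: le_peak.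
  have Ml1 : tau + d <= peak (P k) t1 (P k j).
    by apply: le_trans (le_peak t1 ltlj); rewrite /t1 sl ttau.
  have t1j : t1 j <= tau + d by have := t_le j; rewrite /t1; case: ifP; lra.
  have tj := t_le j; move: (t1 j) (peak _ t1 _) Ml1 t1j => x y Ml1 t1j.
  minmax_lra.
have eM : peak (P k) t1 (P k j) = peak (P k) t (P k j).
  apply: eq_bigr => l ltlj; rewrite /t1; case: ifP => // sl.
  by case/existsP: no; exists l; rewrite ltlj.
have -> : eats P s k j = (0 < s j).
  rewrite /eats; case: ltP => //= sj; apply/forallP => l; apply/implyP => sl.
  by rewrite leqNgt; apply/negP => ltlj; case/existsP: no; exists l; rewrite ltlj.
rewrite eM /t1; case: ifP => sj; last by rewrite addr0.
by rewrite (ttau j sj); minmax_lra.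
Qed.

Lemma eating_invariant_step tau t st :
  eating_invariant tau t st ->
  exists tau' t', eating_invariant tau' t' (ps_step P st).
Proof.
case: st => s x [/= tau0 s0 t_le ttau [xE sE]].
have d0 := phase_len_ge0 s0; set d := phase_len P s in d0 *.
exists (tau + d), (fun j => if 0 < s j then t j + d else t j).
have cd0 j : 0 <= (eaters P s j)%:R * d by rewrite mulr_ge0.
split => /=; rewrite -/d.
- by rewrite addr_ge0.
- by move=> j; rewrite subr_ge0 eatersM_phase_len.
- by move=> j; have := t_le j; case: ifP; lra.
- move=> j sj; have sj0 : 0 < s j by have := cd0 j; lra.
  by rewrite sj0 ttau.
split=> [k j|j]; first by rewrite xE (@share_step _ _ tau).
rewrite sE big_split /= opprD addrA; congr (_ - _).
by rewrite -big_mkcond /= sumr_const mulr_natl /eaters cardsE.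
Qed.

Lemma eating_invariant_le1 tau t st j : eating_invariant tau t st -> st.1 j <= 1.
Proof.
case=> _ _ _ _ [xE ->]; rewrite gerBl sumr_ge0 // => k _.
by rewrite xE share_ge0.
Qed.

Lemma eating_invariant_iter (k : 'I_n) r :
  exists tau t, let st := iter r (ps_step P) (fun _ => 1, fun _ _ => 0) in
  eating_invariant tau t st /\ (#|[set j | (0 < st.1 j)%R]| <= m - r)%N.
Proof.
elim: r => [|r [tau [t [inv card_r]]]].
  exists 0, (fun _ => 0); split; last by rewrite subn0 (leq_trans (max_card _)) ?card_ord.
  have sh0 k' j : share (P k') (fun _ => 0 : R) j = 0.
    rewrite /share; have -> : peak (P k') (fun=> 0 : R) (P k' j) = 0.
      by apply: le_anti; rewrite peak_ge0 peak_le.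
    by rewrite subrr maxxx.
  by split=> //=; split=> // j; rewrite big1 ?subr0.
have [tau' [t' inv']] := eating_invariant_step inv.
exists tau', t'; split=> //; rewrite iterS; move: inv inv' card_r.
set st := iter r _ _ => inv inv' card_r.
have [_ s0 _ _ _] := inv.
have sub : [set j | 0 < (ps_step P st).1 j] \subset [set j | 0 < st.1 j].
  apply/subsetP => j; rewrite !inE /= => sj.
  have : 0 <= (eaters P st.1 j)%:R * phase_len P st.1.
    by rewrite mulr_ge0 // phase_len_ge0.
  by lra.
have [e0|/set0Pn[j]] := eqVneq [set j | 0 < st.1 j] set0.
  by move: sub; rewrite e0 subset0 => /eqP ->; rewrite cards0.
rewrite inE => sj.
(* The item [l] exhausted in this phase makes the set of remaining items shrink strictly. *)
have [l sl el] := phase_exhausts k (fun j => eating_invariant_le1 j inv) sj.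
rewrite subnS -ltnS; apply: leq_trans (leqSpred _).
apply: leq_trans card_r; apply: proper_card; rewrite properE sub /=.
apply/subsetPn; exists l; first by rewrite inE.
by rewrite inE /= el subrr ltxx.
Qed.

(** This is all that the comparison of profiles uses of the mechanism. The agent [k] guarantees that
    somebody eats. *)
Lemma PS_times (k : 'I_n) :
  exists t, (forall k j, @PS R n m P k j = share (P k) t j) /\
            (forall j, \sum_k share (P k) t j = 1).
Proof.
have [tau [t [[_ s0 _ _ [xE sE]] card0]]] := eating_invariant_iter k m.
exists t; split=> // j; move: card0; rewrite subnn leqn0 cards_eq0 => /eqP/setP/(_ j).
rewrite !inE => sj; have := sE j; under eq_bigr do rewrite xE.
by have := s0 j; move/negbT: sj; lra.
Qed.

End EatingTimes.

(** * Comparing the truthful profile [P] with the manipulated profile [Q] *)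

Section Manipulation.
Variables (R : realFieldType) (n m : nat) (P Q : 'I_n -> {perm 'I_m}) (i : 'I_n).
Hypothesis Hnm : (m <= n)%N.
Hypothesis eqPQ : forall k, k != i -> Q k = P k.
Variables t t' : 'I_m -> R.
Hypothesis sumP : forall j, \sum_k share (P k) t j = 1.
Hypothesis sumQ : forall j, \sum_k share (Q k) t' j = 1.

(** Every agent eats at rate 1 until the last item is exhausted, so [n] times that moment is the
    total supply [m]. *)
Lemma peak_all_le1 : peak (Q i) t' m <= 1.
Proof.
have n0 : (0 < n)%N by apply: leq_ltn_trans (ltn_ord i).
have : n%:R * peak (Q i) t' m = m%:R.
  have <- : \sum_(j < m) \sum_k share (Q k) t' j = m%:R.
    by under eq_bigr do rewrite sumQ; rewrite sumr_const card_ord.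
  rewrite exchange_big /= (eq_bigr (fun=> peak (Q i) t' m)).
    by rewrite sumr_const card_ord mulr_natl.
  move=> k _; rewrite sum_share_all.
  by apply: eq_bigl => j; rewrite !ltn_ord.
move=> e; rewrite -(@ler_pM2l _ n%:R) ?ltr0n //.
by rewrite e mulr1 ler_nat.
Qed.

Section Cutoff.
Variable T : R.
Hypothesis T0 : 0 <= T.

Definition early k j := share (Q k) (fun j => Num.min (t' j) T) j.
Definition late k j := Num.max 0 (t' j - Num.max T (peak (Q k) t' (Q k j))).
Definition delayed j := (t j <= T) && (t j < t' j).

Lemma late_ge0 k j : 0 <= late k j.
Proof. by rewrite le_max lexx. Qed.

Lemma early_ge0 k j : 0 <= early k j.
Proof. exact: share_ge0. Qed.

Lemma early_late k j : share (Q k) t' j = early k j + late k j.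
Proof. exact: share_cut. Qed.

Lemma sum_early_le (p : {perm 'I_m}) (s : 'I_m -> R) (D : pred 'I_m) :
  \sum_(j | D j) share p (fun j => Num.min (s j) T) j <= T.
Proof.
apply: le_trans (_ : \sum_j share p (fun j => Num.min (s j) T) j <= T).
  rewrite big_mkcond; apply: ler_sum => j _; case: ifP => // _.
  exact: share_ge0.
rewrite sum_share_all; apply: peak_le => // j _.
by rewrite ge_min lexx orbT.
Qed.

Lemma share_delayed p j : delayed j ->
  share p t j = share p (fun j => Num.min (t j) T) j.
Proof.
case/andP=> tT _; rewrite (share_cut p t j T0).
minmax_lra.
Qed.

(* The agents other than [i] consume at least as much of the delayed items
   before [T] as under the profile [P]. *)
Lemma sum_late_le :
  \sum_(j | delayed j) \sum_k late k j <= T - \sum_(j | delayed j) early i j.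
Proof.
have others k : k != i ->
    \sum_(j | delayed j) share (P k) t j <= \sum_(j | delayed j) early k j.
  move=> /eqPQ ePQ; rewrite (eq_bigr _ (@share_delayed (P k))) /early ePQ.
  (* Times are cut at [T]: an item with [t j > T] then has truthful time [T], which no cut time
     exceeds. *)
  apply: sum_share_le => j; rewrite /delayed ?negb_and -?ltNge -?leNgt.
    by case/andP; minmax_lra.
  by case/orP; minmax_lra.
have own : \sum_(j | delayed j) share (P i) t j <= T.
  by rewrite (eq_bigr _ (@share_delayed (P i))) sum_early_le.
have : \sum_(j | delayed j) \sum_k share (P k) t j =
       \sum_(j | delayed j) \sum_k share (Q k) t' j.
  by apply: eq_bigr => j _; rewrite sumP sumQ.
under [in RHS]eq_bigr do under eq_bigr do rewrite early_late.
under [in RHS]eq_bigr do rewrite big_split /=.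
rewrite big_split /= exchange_big /= [X in _ = X + _]exchange_big /=.
rewrite (bigD1 i) //= [X in _ = X + _](bigD1 i) //=.
have := ler_sum (index_enum _) others.
lra.
Qed.

(** If [j] outlasts [T], some other agent eats it after [T] from no later than [i] does, hence gets
    at least as much of it as [i]. *)
Lemma late_le_half j : T < 1 -> t j <= T ->
  late i j <= 2^-1 * (if delayed j then \sum_k late k j else 0).
Proof.
move=> T1 tT.
have [t'T|Tt'] := leP (t' j) T.
  have -> : late i j = 0 by rewrite /late; minmax_lra.
  case: ifP => _; last by rewrite mulr0.
  by rewrite mulr_ge0 ?invr_ge0 ?sumr_ge0 // => k _; apply: late_ge0.
have Dj : delayed j by rewrite /delayed tT (le_lt_trans tT).
rewrite Dj.
have [/existsP[k /andP[nki le_k]]|alone] := boolP [exists k, (k != i) &&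
    (peak (Q k) t' (Q k j) <= Num.max T (peak (Q i) t' (Q i j)))].
  have le_ik : late i j <= late k j by move: le_k; rewrite /late; minmax_lra.
  rewrite (bigD1 i) //= (bigD1 k) //=.
  have : 0 <= \sum_(l | (l != i) && (l != k)) late l j.
    by apply: sumr_ge0 => l _; apply: late_ge0.
  lra.
(* No one else touched [j] before [T], so all of [j] that [i] has not eaten
   by then is left over, which [sum_late_le] forbids. *)
have early0 k : k != i -> early k j = 0.
  move=> nki; move/existsPn/(_ k): alone; rewrite nki /= -ltNge.
  rewrite /early /share peak_min //; last exact: ltnW.
  minmax_lra.
have := sumQ j; under eq_bigr do rewrite early_late.
rewrite big_split /= (bigD1 i) //= [X in _ + X + _]big1 // => e1.
have := sum_late_le.
rewrite (bigD1 j) //= [X in _ <= _ - X](bigD1 j) //=.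
have : 0 <= \sum_(l | delayed l && (l != j)) \sum_k late k l.
  by apply: sumr_ge0 => l _; apply: sumr_ge0 => k _; apply: late_ge0.
have : 0 <= \sum_(l | delayed l && (l != j)) early i l.
  by apply: sumr_ge0 => l _; apply: early_ge0.
lra.
Qed.

End Cutoff.

Lemma sum_top_share_le r : (r <= m)%N ->
  \sum_(j | (P i j < r)%N) share (Q i) t' j <=
  3%:R / 2%:R * \sum_(j | (P i j < r)%N) share (P i) t j.
Proof.
move=> rm; rewrite [X in _ <= _ * X]sum_share //; set T := peak _ _ _.
have T0 : 0 <= T := peak_ge0 _ _ _.
have [T1|T1] := leP 1 T.
  apply: le_trans (_ : 1 <= _); last by lra.
  apply: le_trans peak_all_le1; rewrite -sum_share_all big_mkcond.
  by apply: ler_sum => j _; case: ifP => // _; apply: share_ge0.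
under eq_bigr do rewrite (early_late T0).
rewrite big_split /=.
have eT : \sum_(j | (P i j < r)%N) early T i j <= T by apply: sum_early_le.
have lT : \sum_(j | (P i j < r)%N) late T i j <= 2^-1 * T.
  (* Delayed items outside the [r] best only enlarge the bound. *)
  apply: le_trans (_ : _ <= 2^-1 * \sum_(j | delayed T j) \sum_k late T k j) _.
    rewrite big_mkcond [X in _ <= _ * X]big_mkcond mulr_sumr.
    apply: ler_sum => j _; case: ifP => [jr|_].
      by apply: late_le_half => //; apply: le_peak.
    case: ifP => _; last by rewrite mulr0.
    by rewrite mulr_ge0 ?invr_ge0 ?sumr_ge0 // => k _; apply: late_ge0.
  rewrite ler_pM2l ?invr_gt0 //; apply: le_trans (sum_late_le T0) _.
  by rewrite gerBl sumr_ge0 // => j _; apply: early_ge0.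
lra.
Qed.

End Manipulation.

Unset Implicit Arguments.

Theorem mainTheorem1 (R : realFieldType) (n m : nat) (Hnm : (m <= n)%N)
    (P : 'I_n -> {perm 'I_m}) (i : 'I_n) (a : 'I_m -> R)
    (ha : forall j, 0 <= a j <= 1)
    (hcompat : forall j j' : 'I_m, (P i j < P i j')%N -> a j' < a j)
    (p' : {perm 'I_m}) :
  utility a (deviate P i p') i <= 3%:R / 2%:R * utility a P i.
Proof.
have [t [PSt sumP]] := @PS_times R n m P i.
have [t' [PSt' sumQ]] := @PS_times R n m (deviate P i p') i.
rewrite -subr_ge0 /utility mulr_sumr -sumrB.
under eq_bigr do rewrite PSt PSt' mulrCA -mulrBr.
(* The summands are 3/2 of the truthful consumption minus the manipulated one, in the order of the
   true ranking. *)
apply: (@abel_sum_ge0 _ _ (P i)) => [j|j j' /hcompat/ltW //|r rm].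
  by case/andP: (ha j).
rewrite sumrB -mulr_sumr subr_ge0; apply: sum_top_share_le => // k nki.
by rewrite /deviate (negbTE nki).
Qed.
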